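(* Let $n\in\mathbb{N}$ and let $\Phi$ be an $N$-function. Then for any real numbers $a_1,\dots,a_n$ the following equality holds: \[ \left\| \sum_{k=1}^n a_k \alpha_k \right\|_{L_{\Phi}(S_n)} = K_{\Phi,n}\,\sqrt{n}\,\left\| \sum_{k=1}^n a_k \alpha_k \right\|_{L^2(S_n)}, \] where \[ K_{\Phi,n} = \|\alpha_n\|_{L_{\Phi}(S_n)} . \]
   Context: $S_n=\{x=(x_1,\dots,x_n)\in\mathbb{R}^n:\ \sum_{k=1}^n x_k^2=1\}$ is the unit sphere in the $n$-dimensional Euclidean space $\mathbb{R}^n$, and $ds$ is the normalized surface (Lebesgue) measure on $S_n$, i.e. the rotation-invariant probability measure on $S_n$. The system of direction cosines $\{\alpha_k\}_{k=1}^n$ consists of the coordinate functions on $S_n$: $\alpha_k(s)=x_k$ for $s=(x_1,\dots,x_n)\in S_n$. An $N$-function is an even, convex and continuous function $\Phi:\mathbb{R}\to[0,\infty)$ such that $\Phi(0)=0$, $\Phi(u)>0$ for $u\neq 0$, $\lim_{u\to0}\Phi(u)/u=0$ and $\lim_{u\to\infty}\Phi(u)/u=\infty$. For an $N$-function $\Phi$, the Orlicz space $L_\Phi(S_n)$ consists of all measurable functions $f:S_n\to\mathbb{R}$ for which there exists $\lambda>0$ with $\int_{S_n}\Phi(|f(s)|/\lambda)\,ds<\infty$; it carries the Luxemburg norm \[ \|f\|_{L_\Phi(S_n)}=\inf\Big\{\lambda>0:\ \int_{S_n}\Phi\Big(\frac{|f(s)|}{\lambda}\Big)\,ds\le 1\Big\}.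 \] Also $\|f\|_{L^2(S_n)}=\big(\int_{S_n}|f(s)|^2\,ds\big)^{1/2}$. *)

(* Defs.v *)
From HB Require Import structures.
From mathcomp Require Import all_boot all_order all_algebra.
From mathcomp Require Import all_classical all_reals all_analysis.

Set Implicit Arguments.
Unset Strict Implicit.
Unset Printing Implicit Defensive.

Import Order.TTheory GRing.Theory Num.Theory.
Import numFieldNormedType.Exports.

Local Open Scope classical_set_scope.
Local Open Scope ring_scope.

Definition sphere (R : realType) (n : nat) : Type :=
  {x : 'rV[R]_n | \sum_(k < n) x 0 k ^+ 2 == 1}.

Definition dircos (R : realType) (n : nat) (k : 'I_n) (s : sphere R n) : R :=
  val s 0 k.

Definition sphere_display : measure_display.
Proof. exact. Qed.

Lemma sphere_point_subproof (R : realType) (n : nat) :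
  \sum_(k < n.+1) (delta_mx 0 ord0 : 'rV[R]_n.+1) 0 k ^+ 2 == 1.
Proof.
rewrite (bigD1 ord0) //= mxE !eqxx expr1n big1 ?addr0 // => k kn0.
by rewrite mxE (negbTE kn0) andbF expr0n.
Qed.

HB.instance Definition _ (R : realType) (n : nat) := Choice.on (sphere R n).
HB.instance Definition _ (R : realType) (n : nat) :=
  isPointed.Build (sphere R n.+1)
    (exist (fun x : 'rV[R]_n.+1 => \sum_(k < n.+1) x 0 k ^+ 2 == 1) _
      (sphere_point_subproof R n)).

(* The Borel sigma-algebra of the sphere, generated by the coordinate
   functions; the ambient dimension is positive because a measurableType is
   inhabited. *)
Section sphere_measurable.
Context (R : realType) (n : nat).

Let coord (k : 'I_n.+1) (s : sphere R n.+1) : measurableTypeR R := dircos k s.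

Let sphere_set0 : g_sigma_preimage coord set0.
Proof. exact: sigma_algebra0. Qed.

Let sphere_setC A : g_sigma_preimage coord A -> g_sigma_preimage coord (~` A).
Proof. exact: sigma_algebraC. Qed.

Let sphere_bigcup (F : (set (sphere R n.+1))^nat) :
  (forall i, g_sigma_preimage coord (F i)) ->
  g_sigma_preimage coord (\bigcup_i (F i)).
Proof. exact: sigma_algebra_bigcup. Qed.

HB.instance Definition _ := @isMeasurable.Build sphere_display
  (sphere R n.+1) (g_sigma_preimage coord) sphere_set0 sphere_setC
  sphere_bigcup.

End sphere_measurable.

Lemma sphere_rot_subproof (R : realType) (n : nat) (A : 'M[R]_n)
    (hA : A *m A^T = 1%:M) (s : sphere R n) :
  \sum_(k < n) (val s *m A) 0 k ^+ 2 == 1.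
Proof.
have sq (y : 'rV[R]_n) : \sum_(k < n) y 0 k ^+ 2 = (y *m y^T) 0 0.
  by rewrite mxE; apply: eq_bigr => k _; rewrite mxE expr2.
by rewrite sq trmx_mul -mulmxA [A *m _]mulmxA hA mul1mx -sq; exact: (valP s).
Qed.

Definition sphere_rot (R : realType) (n : nat) (A : 'M[R]_n)
    (hA : A *m A^T = 1%:M) (s : sphere R n) : sphere R n :=
  exist _ (val s *m A) (sphere_rot_subproof hA s).

(* Rotations range over the whole orthogonal group: in dimension 1 the
   special orthogonal group is trivial and would not determine the measure.  Together
   with being a probability, this characterizes the normalized surface
   measure. *)
Definition rotation_invariant (R : realType) (n : nat)
    (mu : {measure set (sphere R n.+1) -> \bar R}) : Prop :=
  forall (A : 'M[R]_n.+1) (hA : A *m A^T = 1%:M) (B : set (sphere R n.+1)),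
    measurable B -> mu (sphere_rot hA @^-1` B) = mu B.

Record N_function (R : realType) (Phi : R -> R) : Prop := {
  N_function_ge0 : forall u, 0 <= Phi u ;
  N_function_even : forall u, Phi (- u) = Phi u ;
  N_function_convex : convex_function [set: R^o] Phi ;
  N_function_continuous : continuous Phi ;
  N_function0 : Phi 0 = 0 ;
  N_function_gt0 : forall u : R, u != 0 -> 0 < Phi u ;
  N_function_cvg0 : Phi u / u @[u --> 0^'] --> 0 ;
  N_function_cvgy : Phi u / u @[u --> +oo] --> +oo }.

(* The infimum is taken in the extended reals, so that the value is +oo when
   no lambda is admissible, i.e. when f is not in the Orlicz space. *)
Definition luxemburg_norm d (T : measurableType d) (R : realType)
    (mu : {measure set T -> \bar R}) (Phi : R -> R) (f : T -> R) : \bar R :=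
  ereal_inf [set l%:E | l in [set l : R |
    0 < l /\ (\int[mu]_s (Phi (`|f s| / l))%:E <= 1)%E]].

(* Main.v *)
Require Import Defs.
From mathcomp Require Import all_boot all_order all_algebra.
From mathcomp Require Import all_classical all_reals all_analysis.
From mathcomp Require Import measurable_realfun ring.

Import Order.TTheory GRing.Theory Num.Theory.
Import numFieldNormedType.Exports.

Local Open Scope classical_set_scope.
Local Open Scope ring_scope.

(** Write [r] for the Euclidean norm of the coefficient vector [a].  When
    [r] is nonzero, some symmetric orthogonal matrix, a reflection or the
    identity ([reflection_exists]), carries the last basis vector to [a / r],
    so the linear combination of the direction cosines is [r] times the last
    direction cosine composed with an orthogonal map of the sphere.  By invariance
    of the measure, [f] and [r * dircos ord_max] give the same integral to
    every nonnegative measurable function of their values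
    ([integral_lincomb]).

    Both norms depend on nothing but such integrals, and both are
    homogeneous.  The Luxemburg norm of [f] is therefore [r * K].  For the
    L2 norm, all the squared direction cosines have the same integral, and
    they sum to 1 on the sphere, so that integral is the inverse of the
    dimension ([integral_dircos_sqr]) and the L2 norm of [f] is [r] divided
    by the square root of the dimension ([Lnorm2_lincomb]).  The theorem
    compares these two values.  In the case [r = 0] it holds even if [K] is
    infinite, because the product of infinity and 0 is 0 in the extended
    reals. *)

Lemma dotrow_sum {R : nzSemiRingType} {n : nat} (x y : 'rV[R]_n) :
  (x *m y^T) 0 0 = \sum_(k < n) x 0 k * y 0 k.
Proof. by rewrite mxE; apply: eq_bigr => k _; rewrite mxE. Qed.

(** The witness is the reflection in the hyperplane orthogonal to [u - e]
    when [u] and [e] differ. *)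
Lemma reflection_exists {R : realFieldType} {n : nat} {e u : 'rV[R]_n} :
  e *m e^T = 1%:M -> u *m u^T = 1%:M ->
  exists A : 'M[R]_n, [/\ A^T = A, A *m A^T = 1%:M & e *m A = u].
Proof.
move=> ee uu; have [<-|ue] := eqVneq e u.
  by exists 1%:M; rewrite trmx1 !mulmx1.
have [v vE] : exists v, v = u - e by exists (u - e).
have [c cE] : exists c, c = (v *m v^T) 0 0 by eexists.
have vvc : v *m v^T = c%:M by rewrite [LHS]mx11_scalar cE.
have c0 : c != 0.
  apply: contra ue => /eqP; rewrite cE dotrow_sum => /eqP.
  rewrite psumr_eq0 => [/allP v0|k _]; last by rewrite -expr2 sqr_ge0.
  rewrite eq_sym -subr_eq0 -vE; apply/eqP/rowP => k; rewrite [RHS]mxE.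
  by have /(_ (mem_index_enum _)) := v0 k; rewrite -expr2 sqrf_eq0 => /eqP.
have eu : e *m u^T = ((e *m u^T) 0 0)%:M by rewrite [LHS]mx11_scalar.
have ue_eu : u *m e^T = e *m u^T.
  by rewrite -[LHS]trmxK trmx_mul trmxK eu tr_scalar_mx.
(* Both [e] and [u] are unit vectors, so [c = 2 - 2 <e, u>], while
   [<e, v> = <e, u> - 1]. *)
have ev : e *m v^T = (- (c / 2))%:M.
  rewrite [LHS]mx11_scalar cE vE !linearB /= !mulmxBl ue_eu ee uu.
  by rewrite !mxE /=; congr (_%:M); field.
pose P := v^T *m v.
have symP : P^T = P by rewrite trmx_mul trmxK.
have PP : P *m P = c *: P.
  by rewrite mulmxA -(mulmxA v^T) vvc mul_mx_scalar -scalemxAl.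
have eP : e *m P = - (c / 2) *: v by rewrite mulmxA ev mul_scalar_mx.
have symA : (1%:M - (2 / c) *: P)^T = 1%:M - (2 / c) *: P.
  by rewrite linearB linearZ /= trmx1 symP.
clearbody P; exists (1%:M - (2 / c) *: P); split => //.
  rewrite symA mulmxBl mul1mx mulmxBr mulmx1 -scalemxAl -scalemxAr PP !scalerA.
  have -> : 2 / c * (2 / c) * c = 2 / c + 2 / c by field.
  rewrite scalerDl; set Q := (2 / c) *: P.
  by rewrite -[Q - _]opprB addrK opprK subrK.
rewrite mulmxBr mulmx1 -scalemxAr eP scalerA.
have -> : 2 / c * - (c / 2) = -1 by field.
by rewrite scaleN1r opprK vE addrC subrK.
Qed.

Lemma measurable_dircos {R : realType} {n : nat} (k : 'I_n.+1) :
  measurable_fun setT (@dircos R n.+1 k : sphere R n.+1 -> R).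
Proof.
move=> _ Y mY; apply: sub_sigma_algebra.
rewrite -bigcup_mkord_ord; exists k; first exact: ltn_ord.
by exists Y; rewrite ?inord_val.
Qed.

Lemma measurable_lincomb {R : realType} {n : nat} (a : 'I_n.+1 -> R) :
  measurable_fun setT
    (fun s : sphere R n.+1 => \sum_(k < n.+1) a k * dircos k s).
Proof.
apply: measurable_sum => k; apply: measurable_funM => //.
exact: measurable_dircos.
Qed.

(** Each coordinate of a rotated point is a linear combination of the
    coordinates, and the coordinates generate the sigma-algebra. *)
Lemma measurable_sphere_rot {R : realType} {n : nat} {A : 'M[R]_n.+1}
    (hA : A *m A^T = 1%:M) : measurable_fun setT (sphere_rot hA).
Proof.
apply: measurability; first by [].
move=> _ [B + <-]; rewrite -bigcup_mkord_ord => -[k _ [Y mY <-]].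
have mk : measurable_fun setT
    (fun s : sphere R n.+1 => \sum_(j < n.+1) A j (inord k) * dircos j s).
  exact: measurable_lincomb.
have := mk measurableT Y mY; congr measurable.
rewrite !setTI; apply/seteqP; split => s /=;
  rewrite /dircos /= mxE; under eq_bigr do rewrite mulrC; by [].
Qed.

Lemma integral_rot {R : realType} {n : nat}
    {ds : probability (sphere R n.+1) R} (hds : rotation_invariant ds)
    {A : 'M[R]_n.+1} (hA : A *m A^T = 1%:M) {g : sphere R n.+1 -> \bar R} :
  measurable_fun setT g -> (forall s, 0 <= g s)%E ->
  (\int[ds]_s g (sphere_rot hA s) = \int[ds]_s g s)%E.
Proof.
move=> mg g0.
have mr := measurable_sphere_rot hA.
have := ge0_integral_pushforward mr ds measurableT mg (fun s _ => g0 s).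
rewrite preimage_setT => <-; apply: eq_measure_integral => B mB _.
exact: hds.
Qed.

(** The law of a linear combination of the direction cosines depends only on
    the Euclidean norm of its coefficients. *)
Lemma integral_lincomb {R : realType} {n : nat}
    {ds : probability (sphere R n.+1) R} (hds : rotation_invariant ds)
    (a : 'I_n.+1 -> R) {g : R -> \bar R} :
  measurable_fun setT g -> (forall t, 0 <= g t)%E ->
  (\int[ds]_s g (\sum_(k < n.+1) a k * dircos k s)%R =
   \int[ds]_s g (Num.sqrt (\sum_(k < n.+1) a k ^+ 2) *
                 dircos ord_max s)%R)%E.
Proof.
move=> mg g0; set r := Num.sqrt _.
have r2 : r ^+ 2 = \sum_(k < n.+1) a k ^+ 2.
  by rewrite sqr_sqrtr// sumr_ge0// => k _; exact: sqr_ge0.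
have [r0|r0] := eqVneq r 0.
  have a0 k : a k = 0.
    move: r2; rewrite r0 expr0n => /esym/eqP.
    rewrite psumr_eq0 => [/allP/(_ k (mem_index_enum _))|j _].
      by rewrite sqrf_eq0 => /eqP.
    exact: sqr_ge0.
  apply: eq_integral => s _; congr g; rewrite r0 mul0r big1// => k _.
  by rewrite a0 mul0r.
(* The rotation has to send the last basis vector to [a / r]. *)
pose u : 'rV[R]_n.+1 := \row_k (a k / r).
have uu : u *m u^T = 1%:M.
  rewrite [LHS]mx11_scalar dotrow_sum; congr (_%:M).
  under eq_bigr do rewrite mxE -expr2 expr_div_n.
  by rewrite -mulr_suml -r2 divff// expf_neq0.
have ee : delta_mx 0 ord_max *m (delta_mx 0 ord_max : 'rV[R]_n.+1)^T = 1%:M.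
  by rewrite trmx_delta mul_delta_mx; apply/matrixP => i j; rewrite !ord1 !mxE.
have [A [symA hA eA]] := reflection_exists ee uu.
have mh : measurable_fun setT
    (fun s : sphere R n.+1 => g (r * dircos ord_max s)).
  apply: measurableT_comp => //; apply: measurable_funM => //.
  exact: measurable_dircos.
rewrite -(integral_rot hds hA mh)//.
apply: eq_integral => s _; congr g.
(* The last column of [A] is [u^T] because [A] is symmetric. *)
have -> : dircos ord_max (sphere_rot hA s) = (val s *m u^T) 0 0.
  rewrite -eA trmx_mul symA mulmxA trmx_delta.
  by rewrite -colE mxE.
rewrite dotrow_sum mulr_sumr; apply: eq_bigr => k _.
by rewrite mxE [in RHS]mulrCA [r * _]mulrC divfK// mulrC.
Qed.

Lemma integral_dircos_sqr {R : realType} {n : nat}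
    {ds : probability (sphere R n.+1) R} (hds : rotation_invariant ds) :
  (\int[ds]_s (dircos ord_max s ^+ 2)%:E = (n.+1%:R^-1)%:E)%E.
Proof.
have msq : measurable_fun setT (fun t : R => (t ^+ 2)%:E).
  by apply/measurable_EFinP; exact: measurable_funX.
have sq0 (t : R) : (0 <= (t ^+ 2)%:E)%E by rewrite lee_fin sqr_ge0.
have all_eq (k : 'I_n.+1) : (\int[ds]_s (dircos k s ^+ 2)%:E =
    \int[ds]_s (dircos ord_max s ^+ 2)%:E)%E.
  have := integral_lincomb hds (fun j => (j == k)%:R) msq sq0.
  rewrite (bigD1 k)//= eqxx expr1n big1 ?addr0 => [|j /negbTE ->]; last first.
    by rewrite expr0n.
  rewrite sqrtr1; under [in RHS]eq_integral do rewrite mul1r.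
  move=> <-; apply: eq_integral => s _; congr ((_ ^+ 2)%:E).
  rewrite (bigD1 k)//= eqxx mul1r big1 ?addr0// => j /negbTE ->.
  by rewrite mul0r.
have : (\int[ds]_s (\sum_(k < n.+1) (dircos k s ^+ 2)%:E) = 1)%E.
  under eq_integral => s _.
    rewrite sumEFin (_ : \sum_(_ < _) _ = 1); last exact/eqP/(valP s).
    over.
  rewrite integral_cst// mul1e; exact: probability_setT.
rewrite ge0_integral_sum//; last first.
  move=> k; apply/measurable_EFinP; apply: measurable_funX.
  exact: measurable_dircos.
rewrite (eq_bigr (fun=> \int[ds]_s (dircos ord_max s ^+ 2)%:E)%E) => [|k _];
  last exact: all_eq.
have : (0 <= \int[ds]_s (dircos ord_max s ^+ 2)%:E)%E by exact: integral_ge0.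
(* The integral is nonnegative, and finite since the sum would otherwise be
   infinite. *)
case: (\int[ds]_s _)%E => [x _|_|//].
  rewrite sumEFin sumr_const card_ord => -[nx].
  by congr EFin; apply: divr1_eq; rewrite invrK mulr_natr.
by rewrite big_ord_recl addye// -ltNye (lt_le_trans _ (sume_ge0 _ _)).
Qed.

Lemma Lnorm2_lincomb {R : realType} {n : nat}
    {ds : probability (sphere R n.+1) R} (hds : rotation_invariant ds)
    (a : 'I_n.+1 -> R) :
  ('N[ds]_2[EFin \o (fun s => \sum_(k < n.+1) a k * dircos k s)%R] =
   (Num.sqrt (\sum_(k < n.+1) a k ^+ 2) / Num.sqrt n.+1%:R)%:E)%E.
Proof.
rewrite unlock /=.
under eq_integral do
  rewrite /= powR_mulrn ?normr_ge0// real_normK ?num_real//.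
have msq : measurable_fun setT (fun t : R => (t ^+ 2)%:E).
  by apply/measurable_EFinP; exact: measurable_funX.
have sq0 (t : R) : (0 <= (t ^+ 2)%:E)%E by rewrite lee_fin sqr_ge0.
rewrite (integral_lincomb hds a msq sq0).
set r := Num.sqrt (\sum_(k < n.+1) _).
under eq_integral do rewrite exprMn EFinM.
rewrite ge0_integralZl_EFin ?sqr_ge0//=; last first.
  apply/measurable_EFinP; apply: measurable_funX; exact: measurable_dircos.
rewrite integral_dircos_sqr// -EFinM poweR_EFin powR12_sqrt; last first.
  by rewrite mulr_ge0 ?sqr_ge0.
by rewrite sqrtrM ?sqr_ge0// sqrtr_sqr ger0_norm ?sqrtr_ge0// sqrtrV.
Qed.

Lemma luxemburg_normZ {R : realType} {d} {T : measurableType d}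
    (mu : {measure set T -> \bar R}) (Phi : R -> R) (f : T -> R) {r : R} :
  0 < r -> luxemburg_norm mu Phi (fun x => r * f x) =
  (r%:E * luxemburg_norm mu Phi f)%E.
Proof.
move=> r0; rewrite /luxemburg_norm -ereal_inf_pZl//; congr ereal_inf.
have scaled x l : `|r * f x| / (r * l) = `|f x| / l.
  by rewrite normrM gtr0_norm// -mulf_div divff ?gt_eqF// mul1r.
apply/seteqP; split => [_ [l [l0 hl] <-]|_ [_ [l [l0 hl] <-] <-]].
  exists (l / r)%:E; last by rewrite -EFinM mulrC divfK// gt_eqF.
  exists (l / r) => //; split; first exact: divr_gt0.
  suff -> : (fun x => (Phi (`|f x| / (l / r)))%:E) =
      (fun x => (Phi (`|r * f x| / l))%:E) by [].
  apply/funext => x; rewrite -(scaled x (l / r)) [r * (l / r)]mulrC divfK//.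
  by rewrite gt_eqF.
exists (r * l) => //; split; first exact: mulr_gt0.
by under eq_integral do rewrite scaled.
Qed.

Lemma luxemburg_norm0 {R : realType} {d} {T : measurableType d}
    (mu : {measure set T -> \bar R}) {Phi : R -> R} :
  Phi 0 = 0 -> luxemburg_norm mu Phi (fun=> 0) = 0%E.
Proof.
move=> Phi0; apply/eqP; rewrite eq_le; apply/andP; split; last first.
  by apply/ereal_infP => _ [l [l0 _] <-]; rewrite lee_fin ltW.
apply/lee_addgt0Pr => e e0; rewrite add0e; apply: ereal_inf_lbound.
exists e => //; split => //.
by under eq_integral do rewrite normr0 mul0r Phi0; rewrite integral0.
Qed.

Lemma luxemburg_norm_lincomb {R : realType} {n : nat}
    {ds : probability (sphere R n.+1) R} (hds : rotation_invariant ds)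
    {Phi : R -> R} (hPhi : N_function Phi) (a : 'I_n.+1 -> R) :
  luxemburg_norm ds Phi (fun s => \sum_(k < n.+1) a k * dircos k s) =
  luxemburg_norm ds Phi
    (fun s => Num.sqrt (\sum_(k < n.+1) a k ^+ 2) * dircos ord_max s).
Proof.
rewrite /luxemburg_norm; congr ereal_inf; congr image.
apply/funext => l; congr (_ /\ (_ <= 1)%E).
apply: (integral_lincomb hds a (g := fun t => (Phi (`|t| / l))%:E)); last first.
  by move=> t; rewrite lee_fin N_function_ge0.
apply/measurable_EFinP; apply: measurableT_comp.
  apply: continuous_measurable_fun; exact: N_function_continuous hPhi.
by apply: measurable_funM => //; exact: normr_measurable.
Qed.

Theorem theorem3 (R : realType) (n : nat)
    (ds : probability (sphere R n.+1) R) (hds : rotation_invariant ds)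
    (Phi : R -> R) (hPhi : N_function Phi) (a : 'I_n.+1 -> R) :
  let f := fun s : sphere R n.+1 => \sum_(k < n.+1) a k * dircos k s in
  let K := luxemburg_norm ds Phi (@dircos R n.+1 ord_max) in
  luxemburg_norm ds Phi f =
    (K * (Num.sqrt (n.+1%:R : R))%:E * 'N[ds]_2[EFin \o f])%E.
Proof.
move=> f K.
rewrite Lnorm2_lincomb// luxemburg_norm_lincomb//.
set r := Num.sqrt (\sum_(k < n.+1) _).
rewrite -muleA -EFinM [_ * (r / _)]mulrC divfK;
  last by rewrite gt_eqF ?sqrtr_gt0.
have [r0|r0] := eqVneq r 0.
  rewrite r0 mule0 -[RHS](luxemburg_norm0 ds (N_function0 hPhi)).
  by under eq_fun do rewrite mul0r.
by rewrite luxemburg_normZ 1?muleC// lt_def r0 sqrtr_ge0.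
Qed.
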